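(* Let $k\ge1$, $n\ge k+2$, $w=n-k-2$. For $x$ in the group $N$ of real upper unitriangular $n\times n$ matrices set $x^\iota:=Dx^{-1}D$ with $D=\mathrm{diag}(1,-1,1,\dots,(-1)^{n-1})$. (i) If $F$ is a tame $\mathrm{SL}_{k+1}$-frieze pattern of width $w$, then $(A_F)^\iota$ is the matrix $A_{F'}$ of a tame $\mathrm{SL}_{w+1}$-frieze pattern $F'$ of width $k$. (ii) The resulting map $\iota:\mathcal{E}_{k+1,n}\to\mathcal{E}_{w+1,n}$ coincides with $\mathcal{G}\circ *$, the composition of projective duality and the Gale transform.
   Context: An $\mathrm{SL}_{m+1}$-frieze pattern of width $u$ is an array of reals $(d_{i,j})$, $i\in\mathbb{Z}$, $i-m-1\le j\le i+u+m$, with $d_{i,i-1}=d_{i,i+u}=1$, $d_{i,j}=0$ for $j<i-1$ or $j>i+u$, every $(m+1)\times(m+1)$ determinant $\det(d_{i+r,j+s})_{0\le r,s\le m}$ (all entries defined) equal to $1$; tame means every $(m+2)\times(m+2)$ such determinant vanishes. For a frieze $F$ of width $u$ with $n=m+u+2$, $A_F$ is the $n\times n$ upper unitriangular matrix with $(A_F)_{r,c}=d_{r,c-1}$ for $r\le c\le r+u+1$ and $0$ otherwise. For $m\ge0$, $\mathcal{E}_{m+1,n}$ is the set of difference equations $V_i=a_i^1V_{i-1}-\cdots+(-1)^{m-1}a_i^mV_{i-m}+(-1)^mV_{i-m-1}$ with real $n$-periodic coefficients such that all solutions satisfy $V_{i+n}=(-1)^mV_i$; such equations correspond bijectively to tame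 $\mathrm{SL}_{m+1}$-frieze patterns of width $n-m-2$ via $d_{i,j}:=V_j$, $(V_s)$ the solution with $V_{i-m-1}=\dots=V_{i-2}=0$, $V_{i-1}=1$. The projective dual $E^*$ of an equation is $V^*_i=a^m_{i+m-1}V^*_{i-1}-a^{m-1}_{i+m-2}V^*_{i-2}+\cdots+(-1)^{m-1}a^1_iV^*_{i-m}+(-1)^mV^*_{i-m-1}$. The Gale dual $\mathcal{G}(E)\in\mathcal{E}_{w+1,n}$ of $E\in\mathcal{E}_{k+1,n}$ with frieze $(d_{i,j})$ is $W_i=\alpha_i^1W_{i-1}-\cdots+(-1)^{w-1}\alpha_i^wW_{i-w}+(-1)^wW_{i-w-1}$ with $\alpha_i^j:=d_{i+1,w+i-j+1}$.
   Formalization: In (ii), with the stated index conventions, the map ι agrees with G∘* only after re-indexing i→i+1: ι(E) has coefficients α_{i+1}^j where G(E* ) has α_i^j; the unshifted equality fails, e.g. for k=1, n=5, (a_i)=(1,2,2,1,3). *)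

(* Defs.v *)
From mathcomp Require Import all_boot all_order all_algebra.
From mathcomp Require Import boolp classical_sets reals.

Set Implicit Arguments.
Unset Strict Implicit.
Unset Printing Implicit Defensive.

Import Order.TTheory GRing.Theory Num.Theory.

Local Open Scope classical_set_scope.
Local Open Scope ring_scope.

Section Friezes.
Variable R : realType.
Implicit Types (m u p n w : nat) (i : int).

(* A pattern is a partial array; it is represented by a total function of which
   only the values on [frieze_dom] are meaningful. *)
Definition frieze_dom m u i (j : int) : Prop :=
  i - m%:Z - 1 <= j /\ j <= i + u%:Z + m%:Z.

Definition block_defined m u p i (j : int) : Prop :=
  forall r s : 'I_p, frieze_dom m u (i + r%:Z) (j + s%:Z).

Definition block_det (d : int -> int -> R) p i (j : int) : R :=
  \det (\matrix_(r < p, s < p) d (i + r%:Z) (j + s%:Z)).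

(* SL_(m+1)-frieze patterns of width u *)
Definition is_frieze m u (d : int -> int -> R) : Prop :=
  [/\ forall i, d i (i - 1) = 1,
      forall i, d i (i + u%:Z) = 1,
      forall i j, frieze_dom m u i j ->
        j < i - 1 \/ i + u%:Z < j -> d i j = 0
    & forall i j, block_defined m u m.+1 i j -> block_det d m.+1 i j = 1].

Definition tame m u (d : int -> int -> R) : Prop :=
  forall i j, block_defined m u m.+2 i j -> block_det d m.+2 i j = 0.

Definition tame_frieze m u (d : int -> int -> R) : Prop :=
  is_frieze m u d /\ tame m u d.

Definition eq_frieze m u (d d' : int -> int -> R) : Prop :=
  forall i j, frieze_dom m u i j -> d i j = d' i j.

(* Matrices are indexed from 0 whereas rows and columns of A_F are indexed from
   1: entry (r, c) below is (A_F)_(r+1, c+1) = d_(r+1, c). *)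
Definition frieze_mx n u (d : int -> int -> R) : 'M[R]_n :=
  \matrix_(r < n, c < n)
    if (r <= c <= r + u + 1)%N then d r.+1%:Z c%:Z else 0.

Definition sign_mx n : 'M[R]_n := diag_mx (\row_(j < n) (-1) ^+ j).

(* Only used on upper unitriangular x, for which [invmx x] is the inverse. *)
Definition iota_mx n (x : 'M[R]_n) : 'M[R]_n :=
  sign_mx n *m invmx x *m sign_mx n.

(* The equation
     V_i = a_i^1 V_(i-1) - ... + (-1)^(m-1) a_i^m V_(i-m) + (-1)^m V_(i-m-1)
   is given by its coefficients; the superscript is shifted by one, i.e.
   [a i j] with j : 'I_m stands for a_i^(j+1). *)
Definition diff_eq m := int -> 'I_m -> R.

Definition solution m (a : diff_eq m) (V : int -> R) : Prop :=
  forall i, V i = \sum_(j < m) (-1) ^+ j * a i j * V (i - j%:Z - 1)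
                  + (-1) ^+ m * V (i - m%:Z - 1).

(* The set E_(m+1, n) *)
Definition calE m n (a : diff_eq m) : Prop :=
  (forall i j, a (i + n%:Z) j = a i j) /\
  (forall V, solution a V -> forall i, V (i + n%:Z) = (-1) ^+ m * V i).

(* The solution with V_(i-m-1) = ... = V_(i-2) = 0 and V_(i-1) = 1. It exists
   and is unique since the coefficient of V_(i-m-1) in the recurrence is a sign,
   so the default value of [xget] is never reached. *)
Definition fund_solution m (a : diff_eq m) i : int -> R :=
  xget (fun=> 0) [set V | [/\ solution a V,
    forall s : int, i - m%:Z - 1 <= s -> s <= i - 2 -> V s = 0 & V (i - 1) = 1]].

Definition frieze_of m (a : diff_eq m) : int -> int -> R :=
  fun i j => fund_solution a i j.

(* (a* )_i^(j+1) = a_(i+m-j-1)^(m-j); [rev_ord j] has value m - j - 1. *)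
Definition proj_dual m (a : diff_eq m) : diff_eq m :=
  fun i j => a (i + m%:Z - j%:Z - 1) (rev_ord j).

(* alpha_i^(j+1) = d_(i+1, w+i-j), d being the frieze of a *)
Definition gale_dual m w (a : diff_eq m) : diff_eq w :=
  fun i j => frieze_of a (i + 1) (w%:Z + i - j%:Z).

(* With the index conventions above, the map induced by x |-> x^iota is
   [gale_dual w (proj_dual a)] only after re-indexing i |-> i + 1: already for
   m = 1 the former has coefficient alpha_i^1 = a_i^1 and the latter
   alpha_i^1 = a_(i-1)^1. *)
Definition shift_eq m (s : int) (a : diff_eq m) : diff_eq m := fun i j => a (i + s) j.

(* Graph of the map E_(k+1, n) -> E_(w+1, n) induced by x |-> x^iota through the
   correspondence between equations and tame friezes. *)
Definition iota_graph k w n (a : diff_eq k) (b : diff_eq w) : Prop :=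
  calE n b /\
  exists F' : int -> int -> R,
    [/\ tame_frieze w k F',
        frieze_mx n k F' = iota_mx (frieze_mx n w (frieze_of a))
      & eq_frieze w k (frieze_of b) F'].

End Friezes.

Arguments frieze_mx {R} n u d.
Arguments gale_dual {R m} w a.
Arguments iota_graph {R k w} n a b.

(* Main.v *)
Require Import Defs.
From mathcomp Require Import all_boot all_order all_algebra.
From mathcomp Require Import boolp classical_sets reals.
From mathcomp Require Import zify ring.

(** Write [G i j] for the entry [d_(i, j)] of the array of fundamental solutions
of an equation with coefficients [a_i^l] ([a^0 = a^(m+1) = 1]). Cut off below the
diagonal [j = i - 1], [G] is a unitriangular matrix, and the recurrence says that
its inverse is the band matrix of the signed coefficients; hence [x |-> x^iota]
replaces [d_(i, j)] by [a_j^(j+1-i)]. Since a left inverse is a right inverse, the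
rows of [G] satisfy a recurrence too: read in [i] it is the projective dual
equation, and read as a relation for the band of coefficients it is an equation of
order [w + 1] with coefficients [d_(i-l+1, i)], which is the Gale dual of the
projective dual.

The correspondence with tame friezes rests on the fact that an equation lies in
[E_(m+1, n)] as soon as each fundamental solution starting at [i] passes through
[1, 0, ..., 0] at [i + u, ..., i + u + m], [u = n - m - 2]: then
[G (i + n) j = (-1)^m G i j], and the linear independence of consecutive rows makes
the coefficients periodic. *)

Set Implicit Arguments.
Unset Strict Implicit.
Unset Printing Implicit Defensive.

Import Order.TTheory GRing.Theory Num.Theory.

Local Open Scope ring_scope.

(** * Companion matrices and linear recurrences *)

Section Companion.
Variable (R : comUnitRingType) (m : nat).
Implicit Types (c : 'I_m.+1 -> R) (d : int -> int -> R) (i j : int).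

(** Right multiplication by it shifts a row of [m + 1] consecutive values by one place; the new last
    entry is their combination with coefficients [c]. *)
Definition compmx c : 'M[R]_m.+1 :=
  \matrix_(r < m.+1, s < m.+1) if (s < m)%N then (r == s.+1 :> nat)%:R else c r.

(** In row [ord0] only the last entry can be nonzero, and its minor is the identity. *)
Lemma det_compmx c : \det (compmx c) = (-1) ^+ m * c ord0.
Proof.
rewrite (expand_det_row _ ord0) (bigD1 ord_max) //= big1 ?addr0.
  rewrite mxE /= ltnn mulrC /cofactor /=; congr (_ * _).
  rewrite (_ : row' _ _ = 1%:M) ?det1 ?mulr1 ?add0n //.
  apply/matrixP => r s; rewrite !mxE /= /bump.
  have lt_s : (s < m)%N := ltn_ord s.
  have -> : (m <= s)%N = false by lia.
  by rewrite add0n lt_s leq0n add1n eqSS.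
move=> s neq_s; rewrite mxE ifT /=; first by rewrite mul0r.
by have := ltn_ord s; move: neq_s; rewrite -val_eqE /=; lia.
Qed.

Definition blk p q d i j : 'M[R]_(p, q) :=
  \matrix_(r < p, s < q) d (i + r%:Z) (j + s%:Z).

Lemma blk_compmx p d c i j :
  (forall r : 'I_p, d (i + r%:Z) (j + m%:Z + 1) =
    \sum_(q < m.+1) d (i + r%:Z) (j + q%:Z) * c q) ->
  blk p m.+1 d i (j + 1) = blk p m.+1 d i j *m compmx c.
Proof.
move=> dE; apply/matrixP => r s; rewrite !mxE.
have [lt_sm|le_ms] := ltnP s m.
  have s1 : (s.+1 < m.+1)%N by lia.
  rewrite (bigD1 (Ordinal s1)) //= big1 ?addr0.
    rewrite !mxE lt_sm /= eqxx mulr1; congr (d _ _); lia.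
  by move=> q; rewrite -val_eqE /= => /negbTE nq; rewrite !mxE lt_sm nq mulr0.
have sE : s = m :> nat by have := ltn_ord s; lia.
rewrite (_ : j + 1 + s%:Z = j + m%:Z + 1); last lia.
by rewrite dE; apply: eq_bigr => q _; rewrite !mxE sE ltnn.
Qed.

Lemma compmx_blk p d c i j :
  blk p m.+1 d i (j + 1) = blk p m.+1 d i j *m compmx c ->
  forall r : 'I_p, d (i + r%:Z) (j + m%:Z + 1) =
    \sum_(q < m.+1) d (i + r%:Z) (j + q%:Z) * c q.
Proof.
move=> /matrixP E r; have := E r ord_max; rewrite !mxE /=.
rewrite (_ : j + 1 + m%:Z = j + m%:Z + 1); last lia.
by move=> ->; apply: eq_bigr => q _; rewrite !mxE ltnn.
Qed.

End Companion.

(** * Iteration and induction over the integers *)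

Lemma int_orbit (S : Type) (f g : int -> S -> S) (t0 : int) (s0 : S) :
  (forall t, cancel (g t) (f t)) ->
  exists2 x : int -> S, x t0 = s0 & forall t, x (t + 1) = f t (x t).
Proof.
move=> gK.
pose up := fix up (k : nat) := if k is k'.+1 then f (t0 + k'%:Z) (up k') else s0.
(* Going back from [t0 - k'] to [t0 - k' - 1] uses the map [g] at the earlier time, since the
   forward step undoing it is [f] at that time. *)
pose dn := fix dn (k : nat) := if k is k'.+1 then g (t0 - k'%:Z - 1) (dn k') else s0.
pose x (t : int) := if t0 <= t then up (absz (t - t0)%R) else dn (absz (t0 - t)%R).
exists x; first by rewrite /x lexx subrr.
move=> t; rewrite /x; case: (lerP t0 t) => [le_t|lt_t].
  rewrite ifT; last lia.
  rewrite (_ : absz (t + 1 - t0)%R = (absz (t - t0)%R).+1) /=; last lia.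
  by congr (f _ _); lia.
have -> : absz (t0 - t)%R = (absz (t0 - t)%R).-1.+1 by lia.
rewrite /= (_ : t0 - _ - 1 = t); last lia.
rewrite gK; case: (lerP t0 (t + 1)) => h.
  rewrite (_ : absz (t + 1 - t0)%R = 0)%N; last lia.
  by rewrite (_ : (absz (t0 - t)%R).-1 = 0)%N //; lia.
congr dn; lia.
Qed.

Lemma int_step_ind (P : int -> Prop) (t0 : int) :
  P t0 -> (forall t, P t <-> P (t + 1)) -> forall t, P t.
Proof.
move=> P0 PS t.
have up k : P (t0 + k%:Z).
  elim: k => [|k IH]; first by rewrite addr0.
  by rewrite (_ : t0 + _ = t0 + k%:Z + 1); [apply: (iffLR (PS _))|lia].
have dn k : P (t0 - k%:Z).
  elim: k => [|k IH]; first by rewrite subr0.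
  by apply: (iffRL (PS _)); rewrite (_ : _ + 1 = t0 - k%:Z) //; lia.
case: (lerP t0 t) => h.
  by rewrite (_ : t = t0 + (absz (t - t0)%R)%:Z) //; lia.
by rewrite (_ : t = t0 - (absz (t - t0)%R)%:Z) //; lia.
Qed.

(* The coefficients [a^0, ..., a^(m+1)] of the recurrence, with
   [a^0 = a^(m+1) = 1], extended by [0]. *)
Definition ecoef (R : realType) m (al : 'I_m -> R) (l : nat) : R :=
  if l is l'.+1 then
    if insub l' is Some j then al j else (l' == m)%:R
  else 1.

Arguments ecoef : simpl never.

Section Recurrence.
Variable R : realType.

Lemma ecoef0 m (al : 'I_m -> R) : ecoef al 0 = 1.
Proof. by []. Qed.

Lemma ecoefS m (al : 'I_m -> R) (j : 'I_m) : ecoef al j.+1 = al j.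
Proof.
rewrite /ecoef (insubT (fun l => l < m)%N (ltn_ord j)).
by congr al; apply: val_inj.
Qed.

Lemma ecoef_last m (al : 'I_m -> R) : ecoef al m.+1 = 1.
Proof. by rewrite /ecoef insubF ?ltnn ?eqxx. Qed.

Lemma ecoef_out m (al : 'I_m -> R) l : (m.+1 < l)%N -> ecoef al l = 0.
Proof.
case: l => // l lt_ml; rewrite /ecoef insubF; last by apply/negbTE; lia.
by rewrite (_ : (l == m) = false) //; lia.
Qed.

Definition rec_form m (al : 'I_m -> R) (X : int -> R) (j : int) : R :=
  \sum_(l < m.+2) (-1) ^+ l * ecoef al l * X (j - l%:Z).

Lemma solutionP m (a : diff_eq R m) V :
  solution a V <-> forall i, rec_form (a i) V i = 0.
Proof.
suff E i : rec_form (a i) V i = V i -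
    (\sum_(j < m) (-1) ^+ j * a i j * V (i - j%:Z - 1)
                  + (-1) ^+ m * V (i - m%:Z - 1)).
  split=> H i; first by rewrite E H subrr.
  by apply/eqP; rewrite -subr_eq0 -E H.
rewrite /rec_form big_ord_recl big_ord_recr !lift0 ecoef0 ecoef_last.
rewrite opprD !addrA; congr (_ + _ + _).
- by rewrite expr0 !mul1r subr0.
- rewrite -sumrN; apply: eq_bigr => j _.
  rewrite lift0 ecoefS exprS (_ : i - j.+1%:Z = i - j%:Z - 1); last lia.
  by rewrite !mulN1r !mulNr.
- rewrite exprS (_ : i - m.+1%:Z = i - m%:Z - 1); last lia.
  by rewrite mulr1 !mulN1r !mulNr.
Qed.

(** Coefficients of the recurrence solved for its newest term; changing sides turns the sign
    [(-1) ^+ (m - r).+1] into [(-1) ^+ (m - r)]. *)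
Definition last_col m (al : 'I_m -> R) (r : 'I_m.+1) : R :=
  (-1) ^+ (m - r) * ecoef al (m - r).+1.

Lemma rec_form_last_col m (al : 'I_m -> R) X j :
  rec_form al X (j + m%:Z + 1) =
  X (j + m%:Z + 1) - \sum_(r < m.+1) X (j + r%:Z) * last_col al r.
Proof.
rewrite /rec_form big_ord_recl ecoef0 expr0 mulr1 mul1r subr0; congr (_ + _).
rewrite (reindex_inj rev_ord_inj) -sumrN; apply: eq_bigr => r _.
have := ltn_ord r => ltr.
rewrite lift0 /= subSS.
rewrite exprS mulN1r !mulNr mulrC; congr (- (X _ * _)); lia.
Qed.

Definition step_mx m (al : 'I_m -> R) : 'M[R]_m.+1 := compmx (last_col al).

(** The sign of the companion determinant cancels the sign [(-1) ^+ m] of the oldest term. *)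
Lemma det_step_mx m (al : 'I_m -> R) : \det (step_mx al) = 1.
Proof.
by rewrite det_compmx /last_col subn0 ecoef_last mulr1 -expr2 sqrr_sign.
Qed.

Lemma unit_step_mx m (al : 'I_m -> R) : step_mx al \in unitmx.
Proof. by rewrite unitmxE det_step_mx unitr1. Qed.

Lemma blk_step_mx p m (al : 'I_m -> R) d i j :
  (forall r : 'I_p, rec_form al (d (i + r%:Z)) (j + m%:Z + 1) = 0) <->
  blk p m.+1 d i (j + 1) = blk p m.+1 d i j *m step_mx al.
Proof.
split=> H.
  apply: blk_compmx => r; apply/eqP; rewrite -subr_eq0 -rec_form_last_col.
  by rewrite H.
by move=> r; rewrite rec_form_last_col (compmx_blk H) subrr.
Qed.

Definition window m (V : int -> R) (t : int) : 'rV[R]_m.+1 :=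
  blk 1 m.+1 (fun=> V) 0 t.

Lemma windowP m (a : diff_eq R m) V :
  solution a V <->
  forall t, window m V (t + 1) = window m V t *m step_mx (a (t + m%:Z + 1)).
Proof.
rewrite solutionP; split=> H t.
  by apply/blk_step_mx => r; rewrite H.
have /blk_step_mx/(_ ord0) := H (t - m%:Z - 1).
by rewrite (_ : t - m%:Z - 1 + m%:Z + 1 = t) //; lia.
Qed.

Lemma solution_exists m (a : diff_eq R m) (t0 : int) (v : 'rV[R]_m.+1) :
  exists2 V, solution a V & window m V t0 = v.
Proof.
pose f t (x : 'rV[R]_m.+1) := x *m step_mx (a (t + m%:Z + 1)).
pose g t (x : 'rV[R]_m.+1) := x *m invmx (step_mx (a (t + m%:Z + 1))).
have [x x0 xS] := @int_orbit _ f g t0 v (fun t y => mulmxKV (unit_step_mx _) y).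
pose V t := x t 0 0.
(* Each step only shifts the entries, so the first entries of the orbit determine all the others. *)
have VE s : forall t (h : (s < m.+1)%N), x t 0 (Ordinal h) = V (t + s%:Z).
  elim: s => [|s IH] t h.
    by rewrite addr0 /V; congr (x t _ _); apply: val_inj.
  have h' : (s < m.+1)%N by lia.
  rewrite (_ : t + _ = t + 1 + s%:Z); last lia.
  rewrite -(IH _ h') xS /f mxE (bigD1 (Ordinal h)) //= big1 ?addr0.
    rewrite mxE /= ifT ?eqxx ?mulr1 //; lia.
  move=> q; rewrite -val_eqE /= => /negbTE nq.
  by rewrite mxE /= ifT ?nq ?mulr0 //; lia.
have wE t : window m V t = x t.
  apply/rowP => s; rewrite mxE -(VE _ _ (ltn_ord s)); congr (x t _ _).
  exact: val_inj.
exists V; last by rewrite wE.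
by apply/windowP => t; rewrite !wE xS.
Qed.

(** The step matrices are invertible, so agreement on one window spreads in both directions. *)
Lemma solution_unique m (a : diff_eq R m) V W (t0 : int) :
  solution a V -> solution a W ->
  (forall s, t0 <= s -> s <= t0 + m%:Z -> V s = W s) -> V = W.
Proof.
move=> /windowP sV /windowP sW VW; apply/funext => t.
have : window m V t = window m W t.
  move: t; apply: (@int_step_ind (fun t => window m V t = window m W t) t0) => [|t].
    by apply/rowP => s; rewrite !mxE VW //; have := ltn_ord s; lia.
  rewrite sV sW; split=> [->//|].
  by move/(can_inj (mulmxK (unit_step_mx _))).
by move=> /rowP/(_ ord0); rewrite !mxE addr0.
Qed.

Lemma solution0 m (a : diff_eq R m) : solution a (fun=> 0).
Proof. by apply/solutionP => i; apply: big1 => l _; rewrite mulr0. Qed.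

Lemma solutionD m (a : diff_eq R m) V W :
  solution a V -> solution a W -> solution a (fun t => V t + W t).
Proof.
move=> /solutionP sV /solutionP sW; apply/solutionP => i.
rewrite -[RHS]addr0 -{1}(sV i) -(sW i) -big_split /=; apply: eq_bigr => l _.
by rewrite mulrDr.
Qed.

Lemma solutionZ m (a : diff_eq R m) x V :
  solution a V -> solution a (fun t => x * V t).
Proof.
move=> /solutionP sV; apply/solutionP => i.
rewrite -(mulr0 x) -(sV i) mulr_sumr; apply: eq_bigr => l _.
by rewrite mulrCA.
Qed.

Lemma solution_sum m (a : diff_eq R m) (I : finType) (x : I -> R) V :
  (forall r, solution a (V r)) -> solution a (fun t => \sum_r x r * V r t).
Proof.
move=> sV; elim: (index_enum I) => [|r s IH].
  rewrite (_ : (fun t => _) = fun=> 0); first exact: solution0.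
  by apply/funext => t; rewrite big_nil.
rewrite (_ : (fun t => _) = fun t => x r * V r t + \sum_(r <- s) x r * V r t).
  by apply: solutionD => //; apply: solutionZ.
by apply/funext => t; rewrite big_cons.
Qed.

End Recurrence.

(** * Fundamental solutions *)

Lemma big_ord_trunc (V : nmodType) p q (f : nat -> V) :
  (forall l, (p <= l)%N \/ (q <= l)%N -> f l = 0) ->
  \sum_(l < p) f l = \sum_(l < q) f l.
Proof.
wlog le_pq : p q / (p <= q)%N => [H f0|f0].
  by case: (leqP p q) => [/H -> //|/ltnW /H <- // l /or_comm /f0].
rewrite (big_ord_widen _ f le_pq) [RHS](bigID (fun l : 'I_q => l < p)%N) /=.
by rewrite [X in _ + X]big1 ?addr0 // => l; rewrite -leqNgt => h; apply: f0; left.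
Qed.

Lemma big_ord_rev (V : nmodType) J (f : nat -> V) :
  \sum_(l < J.+1) f l = \sum_(l < J.+1) f (J - l)%N.
Proof. by rewrite (reindex_inj rev_ord_inj). Qed.

Section FriezeOf.
Variable R : realType.

Lemma frieze_ofP m (a : diff_eq R m) i :
  [/\ solution a (frieze_of a i),
      forall s : int, i - m%:Z - 1 <= s -> s <= i - 2 -> frieze_of a i s = 0
    & frieze_of a i (i - 1) = 1].
Proof.
apply: (@xgetPex _ (fun=> 0) [set V | [/\ solution a V,
  forall s : int, i - m%:Z - 1 <= s -> s <= i - 2 -> V s = 0 & V (i - 1) = 1]]).
(* The window [0, ..., 0, 1] at [i - m - 1] yields an element of the set, so [xget] does not return
   its default. *)
have [V sV /rowP wV] := solution_exists a (i - m%:Z - 1) (delta_mx 0 ord_max).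
exists V; split=> // [s h1 h2|].
  have h : (absz (s - (i - m%:Z - 1))%R < m.+1)%N by lia.
  have := wV (Ordinal h); rewrite !mxE /= -val_eqE /=.
  rewrite (_ : i - m%:Z - 1 + _ = s); last lia.
  move=> ->; rewrite (_ : (_ == m) = false) //; lia.
have := wV ord_max; rewrite !mxE /= eqxx.
by rewrite (_ : i - m%:Z - 1 + _ = i - 1) //; lia.
Qed.

Lemma frieze_of_sol m (a : diff_eq R m) i : solution a (frieze_of a i).
Proof. by have [] := frieze_ofP a i. Qed.

Lemma frieze_of0 m (a : diff_eq R m) i (s : int) :
  i - m%:Z - 1 <= s -> s <= i - 2 -> frieze_of a i s = 0.
Proof. by have [_ + _] := frieze_ofP a i; apply. Qed.

Lemma frieze_of1 m (a : diff_eq R m) i : frieze_of a i (i - 1) = 1.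
Proof. by have [] := frieze_ofP a i. Qed.

Lemma frieze_of_rec m (a : diff_eq R m) i j :
  rec_form (a j) (frieze_of a i) j = 0.
Proof. by have /solutionP := frieze_of_sol a i. Qed.

Lemma frieze_of_unique m (a : diff_eq R m) i V : solution a V ->
  (forall s : int, i - m%:Z - 1 <= s -> s <= i - 2 -> V s = 0) ->
  V (i - 1) = 1 -> V = frieze_of a i.
Proof.
move=> sV V0 V1.
apply: (@solution_unique _ _ _ _ _ (i - m%:Z - 1) sV (frieze_of_sol a i)) => s h1 h2.
case: (lerP s (i - 2)) => h; first by rewrite V0 ?frieze_of0.
by rewrite (_ : s = i - 1) ?V1 ?frieze_of1 //; lia.
Qed.

(** Here [X] need satisfy the recurrence on a finite range only, as does a row of a frieze; each
    value follows from the [m + 1] preceding ones. *)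
Lemma frieze_of_eq_upto m (a : diff_eq R m) i N (X : int -> R) :
  (forall s : int, i - m%:Z - 1 <= s -> s <= i - 2 -> X s = 0) ->
  X (i - 1) = 1 ->
  (forall j, i <= j -> j <= i + N%:Z -> rec_form (a j) X j = 0) ->
  forall j, i - m%:Z - 1 <= j -> j <= i + N%:Z -> frieze_of a i j = X j.
Proof.
move=> X0 X1 Xrec j h1 h2.
have [p jE] : exists p : nat, j = i - m%:Z - 1 + p%:Z.
  by exists (absz (j - (i - m%:Z - 1))%R); lia.
elim/ltn_ind: p => p IH in j h1 h2 jE *.
case: (lerP j (i - 2)) => h; first by rewrite X0 ?frieze_of0.
case: (eqVneq j (i - 1)) => [->|ne]; first by rewrite X1 frieze_of1.
have {}h : i <= j by lia.
have e1 := frieze_of_rec a i j; have e2 := Xrec j h h2.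
have jE2 : j = j - m%:Z - 1 + m%:Z + 1 by lia.
move: e1 e2; rewrite {2 4}jE2 !rec_form_last_col -jE2.
move/eqP; rewrite subr_eq0 => /eqP ->; move/eqP; rewrite subr_eq0 => /eqP ->.
apply: eq_bigr => r _; congr (_ * _); have := ltn_ord r => ltr.
by apply: (IH (p - m.+1 + r)%N); lia.
Qed.

(** At [j = i - 1] the block is unitriangular, and moving by one column multiplies it by a matrix of
    determinant 1. *)
Lemma det_frieze_of m (a : diff_eq R m) i j :
  \det (blk m.+1 m.+1 (frieze_of a) i j) = 1.
Proof.
pose P j := \det (blk m.+1 m.+1 (frieze_of a) i j) = 1.
move: j; apply: (@int_step_ind P (i - 1)) => [|j]; rewrite {}/P.
  rewrite -det_tr det_trig.
    apply: big1 => r _; rewrite !mxE.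
    by rewrite (_ : i - 1 + r%:Z = i + r%:Z - 1) ?frieze_of1 //; lia.
  apply/is_trig_mxP => r s lt_rs; have := ltn_ord s => lts.
  by rewrite !mxE frieze_of0 //; lia.
rewrite (iffLR (blk_step_mx _ (a (j + m%:Z + 1)) _ _ _)).
  by rewrite det_mulmx det_step_mx mulr1.
by move=> r; apply: frieze_of_rec.
Qed.

Lemma unit_frieze_of m (a : diff_eq R m) i j :
  blk m.+1 m.+1 (frieze_of a) i j \in unitmx.
Proof. by rewrite unitmxE det_frieze_of unitr1. Qed.

Definition coef_array m (a : diff_eq R m) (i j : int) : R :=
  if i - 1 <= j then ecoef (a j) (absz (j + 1 - i)%R) else 0.

Lemma coef_arrayE m (a : diff_eq R m) (i : int) (l : nat) :
  coef_array a i (i + l%:Z - 1) = ecoef (a (i + l%:Z - 1)) l.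
Proof. by rewrite /coef_array ifT; [congr ecoef; lia|lia]. Qed.

(** The cut is explicit because [frieze_of] is nonzero again at [j = i - m - 2]. The offset of the
    columns puts the entries [d i (i - 1)] on the main diagonal. *)
Definition upper_mx N (d : int -> int -> R) (i : int) : 'M[R]_N :=
  \matrix_(r < N, c < N) if (r <= c)%N then d (i + r%:Z) (i + c%:Z - 1) else 0.

Definition sign_array (d : int -> int -> R) (i j : int) : R :=
  (-1) ^+ absz (j + 1 - i)%R * d i j.

(** Entry [(r, c)] of the product is the recurrence at column [i + c - 1] applied to the truncated
    row [i + r]. *)
Lemma upper_mx_inv m (a : diff_eq R m) N i :
  upper_mx N (frieze_of a) i *m upper_mx N (sign_array (coef_array a)) i = 1%:M.
Proof.
apply/matrixP => r c; rewrite !mxE.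
pose Tr j := if i + r%:Z - 1 <= j then frieze_of a (i + r%:Z) j else 0.
pose f l := (-1) ^+ l * ecoef (a (i + c%:Z - 1)) l * Tr (i + c%:Z - 1 - l%:Z).
have ltc := ltn_ord c; have ltr := ltn_ord r.
pose g q := if (q <= c)%N then f (c - q)%N else 0.
transitivity (\sum_(q < N) g q).
  apply: eq_bigr => q _; rewrite !mxE /g.
  case: (leqP q c) => [le_qc|]; last by rewrite mulr0.
  rewrite /sign_array (_ : i + c%:Z - 1 = i + q%:Z + (c - q)%N%:Z - 1); last lia.
  rewrite coef_arrayE (_ : absz _ = c - q)%N; last lia.
  rewrite (_ : i + q%:Z + (c - q)%N%:Z - 1 = i + c%:Z - 1); last lia.
  rewrite /f (_ : i + c%:Z - 1 - _ = i + q%:Z - 1) /Tr; last lia.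
  rewrite mulrC (_ : (i + r%:Z - 1 <= i + q%:Z - 1) = (r <= q)%N) //; lia.
rewrite -(@big_ord_trunc _ c.+1 N g); last by move=> l h; rewrite /g ifF //; lia.
rewrite big_ord_rev (eq_bigr (fun l : 'I_c.+1 => f l)); last first.
  move=> l _; have := ltn_ord l => ltl.
  by rewrite /g leq_subr subKn.
case: (ltngtP c r) => h.
- rewrite (_ : (r == c) = false); last by rewrite -val_eqE /=; lia.
  by apply: big1 => l _; rewrite /f /Tr ifF ?mulr0 //; lia.
(* Above the diagonal the recurrence reaches back at most to [i + r - m - 1], so the truncation
   removes only initial zeros of the row. *)
- rewrite (@big_ord_trunc _ _ m.+2) => [|l [] hl]; last first.
  + by rewrite /f ecoef_out ?mulr0 ?mul0r.
  + by rewrite /f /Tr ifF ?mulr0 //; lia.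
  rewrite (_ : (r == c) = false); last by rewrite -val_eqE /=; lia.
  rewrite -[RHS](frieze_of_rec a (i + r%:Z) (i + c%:Z - 1)); apply: eq_bigr => l _.
  have := ltn_ord l => ltl; rewrite /f /Tr; case: ifP => // /negbT hl.
  by rewrite frieze_of0 //; lia.
- rewrite (val_inj h) eqxx big_ord_recl big1 ?addr0 => [|l _].
    by rewrite /f /Tr h subr0 lexx ecoef0 expr0 !mul1r frieze_of1.
  by rewrite /f /Tr lift0 h ifF ?mulr0 //; lia.
Qed.

(** The product of the two inverse matrices in the opposite order gives the relation at some
    columns; as the left side is a solution in [q], this suffices. *)
Lemma frieze_of_row_rel m (a : diff_eq R m) i q :
  \sum_(l < m.+2)
    (-1) ^+ l * ecoef (a (i + l%:Z - 1)) l * frieze_of a (i + l%:Z) q = 0.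
Proof.
pose H q := \sum_(l < m.+2)
  (-1) ^+ l * ecoef (a (i + l%:Z - 1)) l * frieze_of a (i + l%:Z) q.
suff: H = fun=> 0 by move=> /(congr1 (@^~ q)).
have sH : solution a H.
  apply: (@solution_sum R m a _ _ (fun l : 'I_m.+2 => frieze_of a (i + l%:Z))) => l.
  exact: frieze_of_sol.
(* From column [i + m] on, none of the rows [i, ..., i + m + 1] is truncated; matrices of size
   [2m + 2] contain [m + 1] such columns. *)
apply: (@solution_unique _ _ _ _ _ (i + m%:Z) sH (solution0 a)) => s h1 h2.
have /matrixP E := mulmx1C (upper_mx_inv a (m.+1 + m.+1) i).
have hc : (absz (s + 1 - i)%R < m.+1 + m.+1)%N by lia.
have := E (Ordinal (isT : (0 < m.+1 + m.+1)%N)) (Ordinal hc).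
rewrite !mxE -val_eqE /= (_ : (0 == _) = false)%N; last lia.
rewrite mulr0n => <-.
pose f l := (-1) ^+ l * ecoef (a (i + l%:Z - 1)) l * frieze_of a (i + l%:Z) s.
have f0 l : (m.+1 < l)%N -> f l = 0 by move=> h; rewrite /f ecoef_out ?mulr0 ?mul0r.
rewrite /H (@big_ord_trunc _ _ (m.+1 + m.+1) f); last by move=> l h; apply: f0; lia.
apply: eq_bigr => l _; rewrite !mxE /= addr0 /sign_array coef_arrayE.
rewrite (_ : absz _ = l); last lia.
case: (leqP l m.+1) => hl; last by rewrite f0 // ecoef_out // mulr0 mul0r.
rewrite ifT; last lia.
by rewrite /f (_ : i + Posz (absz _) - 1 = s) //; lia.
Qed.

End FriezeOf.

(** * Closed friezes *)

Section Tame.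
Variable R : realType.

Lemma solution_shift m (a : diff_eq R m) s V :
  solution a V -> solution (shift_eq s a) (fun t => V (t + s)).
Proof.
move=> /solutionP sV; apply/solutionP => i; rewrite -[RHS](sV (i + s)).
by apply: eq_bigr => l _; congr (_ * V _); lia.
Qed.

Lemma solution_span m (a : diff_eq R m) V : solution a V ->
  exists x : 'I_m.+1 -> R, V = fun t => \sum_r x r * frieze_of a r%:Z t.
Proof.
move=> sV; pose x := window m V 0 *m invmx (blk m.+1 m.+1 (frieze_of a) 0 0).
exists (x 0); apply: (@solution_unique _ _ a _ _ 0 sV).
  by apply: solution_sum => r; apply: frieze_of_sol.
move=> s h1 h2; have h : (absz s < m.+1)%N by lia.
have /rowP/(_ (Ordinal h)) : x *m blk m.+1 m.+1 (frieze_of a) 0 0 = window m V 0.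
  by rewrite mulmxKV ?unit_frieze_of.
rewrite !mxE /= (_ : 0 + Posz (absz s) = s); last lia.
move=> <-; apply: eq_bigr => r _.
by rewrite !mxE /= add0r (_ : 0 + Posz (absz s) = s) //; lia.
Qed.

Definition frieze_closed m u (a : diff_eq R m) : Prop :=
  (forall i, frieze_of a i (i + u%:Z) = 1) /\
  (forall i j, i + u%:Z < j -> j <= i + u%:Z + m%:Z -> frieze_of a i j = 0).

(** Antiperiodicity carries the initial zeros to the end of the row; the recurrence at [i - 1] fixes
    the value at [i - m - 2], which is carried to [i + u]. *)
Lemma calE_closed m u (a : diff_eq R m) :
  calE (m + u + 2) a -> frieze_closed u a.
Proof.
case=> _ aE.
have E i j : frieze_of a i j = (-1) ^+ m * frieze_of a i (j - (m + u + 2)%N%:Z).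
  by rewrite -aE ?subrK //; apply: frieze_of_sol.
split=> i => [|j h1 h2]; last by rewrite E frieze_of0 ?mulr0 //; lia.
have := frieze_of_sol a i (i - 1); rewrite frieze_of1 big1 ?add0r => [|j _].
  move=> ->; rewrite E; congr (_ * frieze_of a _ _); lia.
have ltj := ltn_ord j; rewrite frieze_of0 ?mulr0 //; lia.
Qed.

(** The zeros ending row [i] are the initial zeros of row [i + n], where [n = m + u + 2], and the
    recurrence gives the next value [(-1) ^+ m]. *)
Lemma closed_antiperiod m u (a : diff_eq R m) i : frieze_closed u a ->
  frieze_of a (i + (m + u + 2)%N%:Z) = fun t => (-1) ^+ m * frieze_of a i t.
Proof.
move=> [c1 c0]; apply/esym/frieze_of_unique.
- exact/solutionZ/frieze_of_sol.
- by move=> s h1 h2; rewrite c0 ?mulr0 //; lia.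
- have := frieze_of_sol a i (i + (m + u + 2)%N%:Z - 1).
  rewrite big1 ?add0r => [->|j _]; last first.
    have ltj := ltn_ord j; rewrite c0 ?mulr0 //; lia.
  rewrite (_ : _ - m%:Z - 1 = i + u%:Z); last lia.
  by rewrite c1 mulr1 -expr2 sqrr_sign.
Qed.

(* The rows [i + 1, ..., i + m + 1] are linearly independent, so that the row
   relations at [i] and [i + n] have the same coefficients. *)
Lemma closed_periodic m u (a : diff_eq R m) i j : frieze_closed u a ->
  a (i + (m + u + 2)%N%:Z) j = a i j.
Proof.
(* In the row relation at [i0], the coefficient of row [i0 + 1 + j] is [a i j] up to sign. *)
move=> ac; set n := (m + u + 2)%N; set i0 := i - j%:Z.
pose y i (r : nat) : R := (-1) ^+ r.+1 * ecoef (a (i + r%:Z)) r.+1.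
pose x : 'rV[R]_m.+1 := \row_r (y (i0 + n%:Z) r - y i0 r).
have rel i' q :
    \sum_(r < m.+1) y i' r * frieze_of a (i' + 1 + r%:Z) q = - frieze_of a i' q.
  apply/eqP; rewrite -addr_eq0 addrC eq_sym -[X in X == _](frieze_of_row_rel a i' q).
  apply/eqP.
  rewrite big_ord_recl expr0 ecoef0 !mul1r addr0; congr (_ + _).
  apply: eq_bigr => r _; rewrite lift0 /y.
  rewrite (_ : i' + r.+1%:Z - 1 = i' + r%:Z); last lia.
  by rewrite (_ : i' + r.+1%:Z = i' + 1 + r%:Z) //; lia.
have : x *m blk m.+1 m.+1 (frieze_of a) (i0 + 1) 0 = 0.
  apply/rowP => q; rewrite !mxE.
  under eq_bigr do rewrite !mxE mulrBl.
  rewrite sumrB rel; apply/eqP; rewrite subr_eq0; apply/eqP.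
  have := rel (i0 + n%:Z) (0 + q%:Z); rewrite (closed_antiperiod _ ac).
  rewrite (eq_bigr (fun r : 'I_m.+1 => (-1) ^+ m *
      (y (i0 + n%:Z) r * frieze_of a (i0 + 1 + r%:Z) (0 + q%:Z)))) => [|r _].
    by rewrite -mulr_sumr -mulrN; apply: mulfI; rewrite signr_eq0.
  rewrite (_ : i0 + n%:Z + 1 + r%:Z = i0 + 1 + r%:Z + n%:Z); last lia.
  by rewrite (closed_antiperiod _ ac) mulrCA.
move/(congr1 (mulmxr (invmx (blk m.+1 m.+1 (frieze_of a) (i0 + 1) 0)))).
rewrite /= mul0mx mulmxK ?unit_frieze_of // => /rowP/(_ (widen_ord (leqnSn m) j)).
rewrite /x !mxE /y /= !ecoefS -mulrBr (_ : i0 + n%:Z + j%:Z = i + n%:Z); last lia.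
rewrite (_ : i0 + j%:Z = i); last lia.
by move/eqP; rewrite mulf_eq0 signr_eq0 /= subr_eq0 => /eqP.
Qed.

(** Periodic coefficients make [frieze_of] invariant under shifting both indices by [n];
    antiperiodicity in [i] thus becomes antiperiodicity in [j], and the rows span all solutions. *)
Lemma closed_calE m u (a : diff_eq R m) :
  frieze_closed u a -> calE (m + u + 2) a.
Proof.
move=> ac; split=> [i j|]; first exact: closed_periodic.
set n := (m + u + 2)%N.
have aS : shift_eq n%:Z a = a.
  by apply/funext => i; apply/funext => j; apply: closed_periodic.
have E i t : frieze_of a i (t + n%:Z) = (-1) ^+ m * frieze_of a i t.
  have : (fun t => frieze_of a (i + n%:Z) (t + n%:Z)) = frieze_of a i.
    apply: frieze_of_unique.
    - by rewrite -{1}aS; apply/solution_shift/frieze_of_sol.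
    - by move=> s h1 h2; rewrite frieze_of0 //; lia.
    - rewrite (_ : i - 1 + n%:Z = i + n%:Z - 1) ?frieze_of1 //; lia.
  move=> /(congr1 (@^~ t)) /= <-.
  by rewrite (closed_antiperiod _ ac) mulrA -expr2 sqrr_sign mul1r.
move=> V /solution_span[x ->] i; rewrite mulr_sumr; apply: eq_bigr => r _.
by rewrite E mulrCA.
Qed.

(** Tameness holds because the recurrence is a linear dependence between [m + 2] consecutive
    columns. *)
Lemma calE_tame_frieze m u (a : diff_eq R m) :
  calE (m + u + 2) a -> tame_frieze m u (frieze_of a).
Proof.
move=> /calE_closed[c1 c0]; split; [split=> //|].
- exact: frieze_of1.
- by move=> i j [h1 h2] [] h; [rewrite frieze_of0 //; lia|rewrite c0 //; lia].
- by move=> i j _; apply: det_frieze_of.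
move=> i j _; rewrite /block_det -det_tr; apply/eqP/det0P.
exists (\row_(s < m.+2) ((-1) ^+ (m.+1 - s) * ecoef (a (j + m.+1%:Z)) (m.+1 - s))).
  apply/eqP => /rowP/(_ ord_max); rewrite !mxE /= subnn ecoef0 mulr1 => /eqP.
  by rewrite oner_eq0.
apply/rowP => r; rewrite !mxE -[RHS](frieze_of_rec a (i + r%:Z) (j + m.+1%:Z)).
rewrite /rec_form [RHS](reindex_inj rev_ord_inj); apply: eq_bigr => s _.
have lts := ltn_ord s; rewrite !mxE /= subSS; congr (_ * frieze_of a _ _); lia.
Qed.

(** Carries a column relation, with defect [E], one row down. A left kernel vector of the singular
    block annihilates [E]; its last entry is nonzero, as otherwise the invertible block would have a
    left kernel. *)
Lemma vanish_next_row m (d : int -> int -> R) (E : int -> R) (c : 'I_m.+1 -> R) i j :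
  \det (blk m.+2 m.+2 d i j) = 0 -> blk m.+1 m.+1 d i j \in unitmx ->
  (forall r, E r = d r (j + m%:Z + 1) - \sum_(q < m.+1) d r (j + q%:Z) * c q) ->
  (forall r : 'I_m.+1, E (i + r%:Z) = 0) -> E (i + m.+1%:Z) = 0.
Proof.
move=> /eqP/det0P[v v0 vM] dU EE E0.
have vE : v 0 ord_max * E (i + m.+1%:Z) = 0.
  transitivity (\sum_(r < m.+2) v 0 r * E (i + r%:Z)).
    rewrite big_ord_recr /= big1 ?add0r // => r _.
    by rewrite E0 mulr0.
  have vd (s : 'I_m.+2) : \sum_(r < m.+2) v 0 r * d (i + r%:Z) (j + s%:Z) = 0.
    move/rowP: vM => /(_ s); rewrite !mxE => e; rewrite -[RHS]e.
    by apply: eq_bigr => r _; rewrite mxE.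
  under eq_bigr do rewrite EE mulrBr mulr_sumr.
  rewrite sumrB exchange_big /= (_ : j + m%:Z + 1 = j + m.+1%:Z); last lia.
  rewrite (vd ord_max) sub0r big1 ?oppr0 // => q _.
  under eq_bigr do rewrite mulrA.
  by rewrite -mulr_suml (vd (widen_ord (leqnSn _) q)) mul0r.
move/eqP: vE; rewrite mulf_eq0 => /orP[/eqP vmax|/eqP //].
suff v00 : v = 0 by rewrite v00 eqxx in v0.
pose v' : 'rV[R]_m.+1 := \row_r v 0 (widen_ord (leqnSn _) r).
have : v' *m blk m.+1 m.+1 d i j = 0.
  apply/rowP => s; rewrite !mxE.
  move/rowP: vM => /(_ (widen_ord (leqnSn _) s)); rewrite !mxE big_ord_recr /=.
  rewrite vmax mul0r addr0 => e; rewrite -[RHS]e; apply: eq_bigr => r _.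
  by rewrite !mxE.
move/(congr1 (mulmxr (invmx (blk m.+1 m.+1 d i j)))).
rewrite /= mul0mx mulmxK // => v'0.
apply/rowP => r; rewrite mxE; case: (unliftP ord_max r) => [r' ->|-> //].
move/rowP: v'0 => /(_ r'); rewrite !mxE => <-; congr (v 0 _); apply: val_inj.
by rewrite /= /bump leqNgt ltn_ord.
Qed.

End Tame.

(** * From tame friezes to equations *)

Section TameToEquation.
Variable R : realType.

Lemma tame_column_rel m u (F : int -> int -> R) j : tame_frieze m u F ->
  exists al : 'I_m -> R,
    forall i, i <= j -> j <= i + u%:Z + m%:Z -> rec_form al (F i) j = 0.
Proof.
move=> [[_ _ _ Fdet] Ftame].
(* [i0] is the first row in which column [j] is defined, and [t, ..., t + m] are the columns
   preceding [j]. Rows [i0, ..., i0 + m] determine the coefficients. *)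
pose t := j - m%:Z - 1; pose i0 := j - m%:Z - u%:Z.
have jE : j = t + m%:Z + 1 by rewrite /t; lia.
have Fdet' i s : i - 1 <= s -> s <= i + u%:Z -> \det (blk m.+1 m.+1 F i s) = 1.
  move=> h1 h2; apply: Fdet => r r'; have := ltn_ord r; have := ltn_ord r'.
  by rewrite /frieze_dom; lia.
have Funit i s : i - 1 <= s -> s <= i + u%:Z -> blk m.+1 m.+1 F i s \in unitmx.
  by move=> h1 h2; rewrite unitmxE Fdet' ?unitr1.
pose cv : 'cV[R]_m.+1 := invmx (blk m.+1 m.+1 F i0 t) *m \col_r F (i0 + r%:Z) j.
pose c q := cv q 0.
pose E r := F r (t + m%:Z + 1) - \sum_(q < m.+1) F r (t + q%:Z) * c q.
have E0 p : (p <= u + m)%N -> E (i0 + p%:Z) = 0.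
  elim/ltn_ind: p => p IH le_p; case: (leqP p m) => [le_pm|lt_mp].
    have /matrixP/(_ (Ordinal (le_pm : p < m.+1)%N) 0) :
        blk m.+1 m.+1 F i0 t *m cv = \col_r F (i0 + r%:Z) j.
      by rewrite mulKVmx // Funit // /i0 /t; lia.
    rewrite !mxE /= /E -jE => <-; apply/eqP; rewrite subr_eq0; apply/eqP.
    by apply: eq_bigr => q _; rewrite mxE.
  rewrite (_ : i0 + p%:Z = i0 + (p - m.+1)%N%:Z + m.+1%:Z); last lia.
  apply: (@vanish_next_row _ _ F E c (i0 + (p - m.+1)%N%:Z) t) => //.
  - apply: Ftame => r r'; have := ltn_ord r; have := ltn_ord r'.
    by rewrite /frieze_dom /i0 /t; lia.
  - by rewrite Funit // /i0 /t; lia.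
  - move=> r; have := ltn_ord r => ltr.
    rewrite (_ : _ + r%:Z = i0 + (p - m.+1 + r)%N%:Z); last lia.
    by apply: IH; lia.
(* Two neighbouring blocks have determinant 1 and differ by the companion matrix of [c], which
   forces its determinant to be 1. *)
have c0 : c ord0 = (-1) ^+ m.
  have : \det (blk m.+1 m.+1 F i0 (t + 1)) = 1 by apply: Fdet'; rewrite /i0 /t; lia.
  rewrite (blk_compmx (c := c)) => [|r].
    rewrite det_mulmx det_compmx Fdet' ?mul1r; [|rewrite /i0 /t; lia..].
    by move/(congr1 ( *%R ((-1) ^+ m))); rewrite mulrA -expr2 sqrr_sign mul1r mulr1.
  have ltr := ltn_ord r; apply/eqP; rewrite -subr_eq0; apply/eqP.
  by apply: E0; lia.
pose al (p : 'I_m) := (-1) ^+ p * c (inord (m - p)).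
have alE : last_col al =1 c.
  move=> r; have ltr := ltn_ord r; rewrite /last_col; case: (posnP r) => [r0|r_gt0].
    rewrite r0 subn0 ecoef_last mulr1 -c0; congr c; exact: val_inj.
  have lt : (m - r < m)%N by lia.
  rewrite (ecoefS al (Ordinal lt)) /al /= mulrA -expr2 sqrr_sign mul1r; congr c.
  by apply: val_inj; rewrite /= inordK; lia.
exists al => i h1 h2; rewrite jE rec_form_last_col.
rewrite (eq_bigr _ (fun r _ => congr1 _ (alE r))) -/(E i).
have -> : i = i0 + (absz (i - i0)%R)%:Z by rewrite /i0; lia.
by apply: E0; rewrite /i0; lia.
Qed.

(** The coefficients are chosen separately for each column; their periodicity then follows from the
    border of ones and zeros of [F]. *)
Lemma tame_frieze_calE m u (F : int -> int -> R) : tame_frieze m u F ->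
  exists2 a : diff_eq R m, calE (m + u + 2) a & eq_frieze m u (frieze_of a) F.
Proof.
move=> Ft; have [[F1 Fu F0 _] _] := Ft.
have [a aP] := choice (fun j => tame_column_rel j Ft).
have aF : eq_frieze m u (frieze_of a) F.
  move=> i j [h1 h2]; apply: (@frieze_of_eq_upto _ _ _ _ (u + m)) => //; last lia.
  - by move=> s h3 h4; apply: F0; [rewrite /frieze_dom; lia|lia].
  - by move=> s h3 h4; apply: aP; lia.
exists a => //; apply: closed_calE; split=> [i|i j h1 h2].
  by rewrite aF // /frieze_dom; lia.
by rewrite aF ?F0 // /frieze_dom; lia.
Qed.

End TameToEquation.

(** * Duality *)

(** For [a] in [calE] with [n = k + w + 2] this is the shifted Gale dual of the projective dual,
    written directly in terms of the frieze of [a]. *)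
Definition dual_eq (R : realType) k w (a : diff_eq R k) : diff_eq R w :=
  fun i j => frieze_of a (i - j%:Z) i.

Arguments dual_eq {R k} w a.

Section Duality.
Variable R : realType.

Lemma ecoef_proj_dual k (a : diff_eq R k) i l : (l <= k.+1)%N ->
  ecoef (proj_dual a i) l = ecoef (a (i + k%:Z - l%:Z)) (k.+1 - l).
Proof.
case: l => [|l] le_l; first by rewrite ecoef0 subn0 ecoef_last.
case: (ltnP l k) => [lt_l|ge_l]; last first.
  by rewrite (_ : l = k) ?subnn ?ecoef0 ?ecoef_last //; lia.
rewrite (ecoefS _ (Ordinal lt_l)) /proj_dual subSS.
have -> : (k - l)%N = (rev_ord (Ordinal lt_l)).+1 by rewrite /=; lia.
by rewrite ecoefS; congr a; rewrite /=; lia.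
Qed.

(** Projective duality reflects the frieze: the row relation, read backwards in the row index, is
    the dual recurrence. *)
Lemma frieze_of_proj_dual k w (a : diff_eq R k) i : calE (k + w + 2) a ->
  frieze_of (proj_dual a) i = fun j => frieze_of a (j - w%:Z - 1) (i - 2).
Proof.
move=> aE; have [c1 c0] := calE_closed aE; apply/esym/frieze_of_unique.
- apply/solutionP => j.
  rewrite -[RHS](mulr0 ((-1) ^+ k.+1)).
  rewrite -(frieze_of_row_rel a (j - w%:Z - 1 - k%:Z - 1) (i - 2)) mulr_sumr.
  rewrite /rec_form (reindex_inj rev_ord_inj); apply: eq_bigr => l _.
  have ltl := ltn_ord l; rewrite /= subSS.
  rewrite ecoef_proj_dual ?leq_subr // subKn // -signr_odd oddB //.
  rewrite !mulrA -exprD -[in RHS]signr_odd oddD.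
  (* The two coefficient indices differ by exactly one period [n = k + w + 2]. *)
  rewrite (_ : j + k%:Z - (k.+1 - l)%N%:Z =
    j - w%:Z - 1 - k%:Z - 1 + l%:Z - 1 + (k + w + 2)%N%:Z); last lia.
  rewrite (_ : a (_ + (k + w + 2)%N%:Z) = a (j - w%:Z - 1 - k%:Z - 1 + l%:Z - 1));
    last by apply/funext => p; rewrite aE.1.
  by congr (_ * frieze_of a _ _); lia.
- by move=> s h1 h2; apply: c0; lia.
- by rewrite -[RHS](c1 (i - 1 - w%:Z - 1)); congr frieze_of; lia.
Qed.

Lemma calE_proj_dual k w (a : diff_eq R k) :
  calE (k + w + 2) a -> calE (k + w + 2) (proj_dual a).
Proof.
move=> aE; apply: closed_calE; split=> [i|i j h1 h2]; rewrite (frieze_of_proj_dual _ aE).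
  by rewrite -[RHS](frieze_of1 a (i - 1)); congr frieze_of; lia.
by apply: frieze_of0; lia.
Qed.

Lemma ecoef_dual_eq k w (a : diff_eq R k) i l : frieze_closed w a ->
  (l <= w.+1)%N -> ecoef (dual_eq w a i) l = frieze_of a (i - l%:Z + 1) i.
Proof.
move=> [c1 _]; case: l => [|l] le_l.
  by rewrite ecoef0 -[LHS](frieze_of1 a (i + 1)); congr frieze_of; lia.
case: (ltnP l w) => [lt_l|ge_l].
  by rewrite (ecoefS _ (Ordinal lt_l)) /dual_eq; congr frieze_of; rewrite /=; lia.
rewrite (_ : l = w); last lia.
by rewrite ecoef_last -[LHS](c1 (i - w%:Z)); congr frieze_of; lia.
Qed.

(** This is the row relation at [(i, j)] with roles exchanged: the frieze entries become
    coefficients, and the coefficients become the sequence. *)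
Lemma coef_array_rec k w (a : diff_eq R k) i j : frieze_closed w a ->
  i <= j -> j <= i + k%:Z + w%:Z -> rec_form (dual_eq w a j) (coef_array a i) j = 0.
Proof.
move=> ac h1 h2; have [c1 c0] := ac.
have [J jE] : exists J : nat, j = i + J%:Z - 1 by exists (absz (j + 1 - i)%R); lia.
pose f l := (-1) ^+ l * frieze_of a (j - l%:Z + 1) j * coef_array a i (j - l%:Z).
rewrite /rec_form (eq_bigr (fun l : 'I_w.+2 => f l)); last first.
  by move=> l _; have ltl := ltn_ord l; rewrite ecoef_dual_eq.
(* The bound on [j] keeps the extra terms [l > w + 1] within the zeros after the frieze; terms
   [l > J] lie below the diagonal of [coef_array]. *)
rewrite (@big_ord_trunc _ _ J.+1 f).
  rewrite big_ord_rev.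
  pose h l := (-1) ^+ l * ecoef (a (i + l%:Z - 1)) l * frieze_of a (i + l%:Z) j.
  rewrite (eq_bigr (fun l : 'I_J.+1 => (-1) ^+ J * h l)) => [|l _]; last first.
    have ltl := ltn_ord l.
    rewrite /f /h -signr_odd oddB // signr_addb !signr_odd.
    rewrite (_ : j - (J - l)%N%:Z = i + l%:Z - 1); last lia.
    rewrite coef_arrayE subrK; ring.
  rewrite -mulr_sumr (@big_ord_trunc _ _ k.+2 h) => [|l]; last first.
    case=> hl; last by rewrite /h ecoef_out ?mulr0 ?mul0r.
    case: (leqP l k.+1) => hl2; last by rewrite /h ecoef_out ?mulr0 ?mul0r.
    by rewrite /h frieze_of0 ?mulr0 //; lia.
  by rewrite frieze_of_row_rel mulr0.
move=> l; case: (leqP l J) => hl [] hl2; try lia.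
- by rewrite /f c0 ?mulr0 ?mul0r //; lia.
- by rewrite /f /coef_array ifF ?mulr0 //; lia.
- by rewrite /f /coef_array ifF ?mulr0 //; lia.
Qed.

Lemma frieze_of_dual_eq k w (a : diff_eq R k) i j : frieze_closed w a ->
  frieze_dom w k i j -> frieze_of (dual_eq w a) i j = coef_array a i j.
Proof.
move=> ac [h1 h2]; apply: (@frieze_of_eq_upto _ _ _ _ (k + w)) => //; last lia.
- by move=> s h3 h4; rewrite /coef_array ifF //; lia.
- by rewrite /coef_array lexx subrK subrr.
- by move=> s h3 h4; apply: coef_array_rec => //; lia.
Qed.

Lemma calE_dual_eq k w (a : diff_eq R k) :
  frieze_closed w a -> calE (w + k + 2) (dual_eq w a).
Proof.
move=> ac; apply: closed_calE; split=> [i|i j h1 h2]; rewrite frieze_of_dual_eq //;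
  try by rewrite /frieze_dom; lia.
- rewrite (_ : i + k%:Z = i + k.+1%:Z - 1); last lia.
  by rewrite coef_arrayE ecoef_last.
- by rewrite /coef_array; case: ifP => // _; rewrite ecoef_out //; lia.
Qed.

(** * Frieze matrices and the map [iota_mx] *)

Lemma frieze_mx_closed k w (a : diff_eq R k) : frieze_closed w a ->
  frieze_mx (k + w + 2) w (frieze_of a) = upper_mx (k + w + 2) (frieze_of a) 1.
Proof.
move=> [_ c0]; apply/matrixP => r c; rewrite !mxE.
have ltc := ltn_ord c; case: (leqP r c) => //= le_rc.
rewrite (_ : 1 + r%:Z = r.+1%:Z); last lia.
rewrite (_ : 1 + c%:Z - 1 = c%:Z); last lia.
by case: leqP => // h; rewrite c0 //; lia.
Qed.

Lemma sign_mx_upper_mx N (d : int -> int -> R) i :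
  sign_mx R N *m upper_mx N (sign_array d) i *m sign_mx R N = upper_mx N d i.
Proof.
rewrite /sign_mx mul_diag_mx mul_mx_diag; apply/matrixP => r c; rewrite !mxE.
case: leqP => [le_rc|]; last by rewrite mulr0 mul0r.
rewrite /sign_array (_ : absz _ = c - r)%N; last lia.
rewrite -(signr_odd _ (c - r)%N) oddB // signr_addb !signr_odd.
transitivity (((-1) ^+ r) ^+ 2 * ((-1) ^+ c) ^+ 2 * d (i + r%:Z) (i + c%:Z - 1)).
  by ring.
by rewrite !sqrr_sign !mul1r.
Qed.

Lemma frieze_mx_iota k w (a : diff_eq R k) : frieze_closed w a ->
  frieze_mx (k + w + 2) k (frieze_of (dual_eq w a)) =
  iota_mx (frieze_mx (k + w + 2) w (frieze_of a)).
Proof.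
move=> ac; rewrite (frieze_mx_closed ac) /iota_mx.
have TU := upper_mx_inv a (k + w + 2) 1.
have [T_unit _] := mulmx1_unit TU.
have -> : invmx (upper_mx (k + w + 2) (frieze_of a) 1) =
    upper_mx (k + w + 2) (sign_array (coef_array a)) 1.
  by rewrite -[LHS]mulmx1 -TU mulKmx.
rewrite sign_mx_upper_mx; apply/matrixP => r c; rewrite !mxE.
have ltc := ltn_ord c; case: (leqP r c) => //= le_rc.
rewrite (_ : 1 + r%:Z = r.+1%:Z); last lia.
rewrite (_ : 1 + c%:Z - 1 = c%:Z); last lia.
case: leqP => h; first by rewrite frieze_of_dual_eq // /frieze_dom; lia.
by rewrite /coef_array; case: ifP => // _; rewrite ecoef_out //; lia.
Qed.

Lemma eq_frieze_mx m u n (d d' : int -> int -> R) :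
  eq_frieze m u d d' -> frieze_mx n u d = frieze_mx n u d'.
Proof.
move=> dd'; apply/matrixP => r c; rewrite !mxE; case: ifP => // h.
by apply: dd'; rewrite /frieze_dom; lia.
Qed.

(* The matrix contains a full period of each of the rows [1, ..., m + 1], and
   these rows span the space of solutions. *)
Lemma frieze_mx_inj m u (a b : diff_eq R m) :
  calE (m + u + 2) a -> calE (m + u + 2) b ->
  frieze_mx (m + u + 2) u (frieze_of a) = frieze_mx (m + u + 2) u (frieze_of b) ->
  a = b.
Proof.
set n := (m + u + 2)%N => aE bE ab.
have row (r : 'I_m.+1) : frieze_of a (1 + r%:Z) = frieze_of b (1 + r%:Z).
  have ltr := ltn_ord r.
  have win j : 0 <= j -> j < n%:Z -> frieze_of a (1 + r%:Z) j = frieze_of b (1 + r%:Z) j.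
    move=> h1 h2; case: (lerP r%:Z j) => hj; last by rewrite !frieze_of0 //; lia.
    case: (lerP j (r%:Z + u%:Z + 1)) => hj2; last first.
      rewrite (calE_closed aE).2; [|lia|lia].
      by rewrite (calE_closed bE).2 //; lia.
    have hr : (r < n)%N by lia.
    have hc : (absz j < n)%N by lia.
    move/matrixP: ab => /(_ (Ordinal hr) (Ordinal hc)); rewrite !mxE /=.
    rewrite !ifT; [|lia..].
    rewrite (_ : r.+1%:Z = 1 + r%:Z); last lia.
    by rewrite (_ : Posz (absz j) = j) //; lia.
  apply/funext => t; move: t.
  suff H (t : int) : (forall s, t <= s -> s < t + n%:Z ->
      frieze_of a (1 + r%:Z) s = frieze_of b (1 + r%:Z) s).
    by move=> t; apply: (H t); lia.
  (* A window of length [n] slides by one either way; the value entering it is [(-1) ^+ m] times the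
     value leaving it. *)
  move: t; apply: (@int_step_ind _ 0) => [s h1 h2|t]; first by apply: win; lia.
  have E (c : diff_eq R m) s : calE n c ->
      frieze_of c (1 + r%:Z) (s + n%:Z) = (-1) ^+ m * frieze_of c (1 + r%:Z) s.
    by case=> _; apply; apply: frieze_of_sol.
  split=> H s h1 h2.
    case: (ltrP s (t + n%:Z)) => hs; first by apply: H; lia.
    rewrite (_ : s = t + n%:Z); last lia.
    by rewrite !E // H //; lia.
  case: (ltrP t s) => hs; first by apply: H; lia.
  rewrite (_ : s = t); last lia.
  have := H (t + n%:Z); rewrite !E // => /(_ _ _)/(mulfI _); apply; try lia.
  by rewrite signr_eq0.
apply/funext => j; apply/funext => p.
(* Both recurrences hold on the same rows, so the difference of their coefficient columns lies in
   the kernel of this invertible block. *)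
pose M := blk m.+1 m.+1 (frieze_of a) 1 (j - m%:Z - 1).
pose x : 'cV[R]_m.+1 := \col_q (last_col (a j) q - last_col (b j) q).
have jE : j = j - m%:Z - 1 + m%:Z + 1 by lia.
have : M *m x = 0.
  apply/colP => r; rewrite !mxE.
  under eq_bigr do rewrite !mxE mulrBr.
  rewrite sumrB.
  have := frieze_of_rec a (1 + r%:Z) j; have := frieze_of_rec b (1 + r%:Z) j.
  rewrite -row {2 4}jE !rec_form_last_col => e1 e2.
  apply/eqP; rewrite subr_eq0; apply/eqP.
  apply/oppr_inj/(addrI (frieze_of a (1 + r%:Z) (j - m%:Z - 1 + m%:Z + 1))).
  by rewrite e1 e2.
move/(congr1 (mulmx (invmx M))); rewrite mulmx0 mulKmx ?unit_frieze_of // => x0.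
have ltp := ltn_ord p; have hp : (m - p < m.+1)%N by lia.
move/colP: x0 => /(_ (Ordinal hp)); rewrite /x !mxE /last_col /=.
rewrite (_ : m - (m - p) = p)%N; last lia.
rewrite !ecoefS -mulrBr => /eqP; rewrite mulf_eq0 signr_eq0 /= subr_eq0.
by move/eqP.
Qed.

Lemma calE_shift m n (a : diff_eq R m) s : calE n a -> calE n (shift_eq s a).
Proof.
case=> per anti; split=> [i j|V /(solution_shift (- s)) sV i].
  by rewrite /shift_eq -[RHS]per; congr a; lia.
have aK : shift_eq (- s) (shift_eq s a) = a.
  by apply/funext => t; apply/funext => p; rewrite /shift_eq subrK.
rewrite aK in sV; have := anti _ sV (i + s).
by rewrite addrK (_ : i + s + n%:Z - s = i + n%:Z) //; lia.
Qed.

End Duality.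

Theorem theorem6p2 (R : realType) (k n w : nat) (hk : (1 <= k)%N)
    (hn : (k + 2 <= n)%N) (hw : w = (n - k - 2)%N) :
  (forall F : int -> int -> R, tame_frieze k w F ->
     exists F' : int -> int -> R,
       tame_frieze w k F' /\ frieze_mx n k F' = iota_mx (frieze_mx n w F))
  /\
  (forall a : diff_eq R k, calE n a ->
     [/\ calE n (proj_dual a),
         calE n (gale_dual w (proj_dual a))
       & forall b : diff_eq R w,
           iota_graph n a b <-> b = shift_eq 1 (gale_dual w (proj_dual a))]).
Proof.
have nE : n = (k + w + 2)%N by lia.
have nE' : (k + w + 2 = w + k + 2)%N by lia.
clear hn hw; subst n; split=> [F /tame_frieze_calE[a aE aF]|a aE].
  have ac := calE_closed aE.
  exists (frieze_of (dual_eq w a)); split; first exact/calE_tame_frieze/calE_dual_eq.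
  by rewrite frieze_mx_iota // (eq_frieze_mx _ aF).
have ac := calE_closed aE.
(* The reflection of the frieze turns the Gale coefficients of the projective dual into entries of
   the frieze of [a]. *)
have dualE : shift_eq 1 (gale_dual w (proj_dual a)) = dual_eq w a.
  apply/funext => i; apply/funext => j.
  rewrite /shift_eq /gale_dual (frieze_of_proj_dual _ aE) /dual_eq.
  congr frieze_of; lia.
have bE : calE (k + w + 2) (dual_eq w a) by rewrite nE'; apply: calE_dual_eq.
split; first exact: calE_proj_dual.
  rewrite (_ : gale_dual w _ = shift_eq (- 1) (dual_eq w a)); first exact: calE_shift.
  by rewrite -dualE; apply/funext => i; apply/funext => j; rewrite /shift_eq subrK.
(* Uniqueness: [b] and [dual_eq w a] have the same frieze matrix, which determines an equation of
   [calE]. *)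
move=> b; rewrite dualE; split=> [[b'E [F' [_ F'mx bF']]]|->].
  rewrite nE' in b'E bE; apply: (frieze_mx_inj b'E bE).
  by rewrite -nE' (eq_frieze_mx _ bF') F'mx frieze_mx_iota.
split=> //; exists (frieze_of (dual_eq w a)); split=> //; last exact: frieze_mx_iota.
exact/calE_tame_frieze/calE_dual_eq.
Qed.
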